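(* Let $(X,\delta)$ be an ordinal space with $|X|=4$. The following conditions are equivalent: (i) $X$ is embeddable in $\mathbb R^1$. (ii) There exists an enumeration $x_1,x_2,x_3,x_4$ of the points of $X$ satisfying the majorization property. (iii) There exists an enumeration $x_1,x_2,x_3,x_4$ of the points of $X$ such that the following two conditions hold: (1) $\delta(x_1,x_2)<\delta(x_1,x_3)<\delta(x_1,x_4)>\delta(x_2,x_4)>\delta(x_3,x_4)$, and $\delta(x_2,x_3)<\delta(x_1,x_3)$, $\delta(x_2,x_3)<\delta(x_2,x_4)$; (2) $(\delta(x_1,x_3)<\delta(x_2,x_4))\Leftrightarrow(\delta(x_1,x_2)<\delta(x_3,x_4))$ and $(\delta(x_1,x_3)=\delta(x_2,x_4))\Leftrightarrow(\delta(x_1,x_2)=\delta(x_3,x_4))$.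
   Context: An ordinal space is an ordered triplet $(X,L,\delta)$, also written $(X,\delta)$, where $X$ is a set, $L$ is a linearly ordered set with minimal element $0$, and $\delta\colon X\times X\to L$ is a surjective mapping such that for all $x,y\in X$: (i) $\delta(x,y)=\delta(y,x)$; (ii) $\delta(x,y)=0$ if and only if $x=y$. $X$ is embeddable in $\mathbb R^m$ (written $X\hookrightarrow\mathbb R^m$) if there is a mapping $\Phi\colon X\to\mathbb R^m$ such that for all $x,y,z,w\in X$ the comparison ($<$, $=$ or $>$) of $\delta(x,y)$ with $\delta(z,w)$ is the same as that of the Euclidean distances $d(\Phi(x),\Phi(y))$ and $d(\Phi(z),\Phi(w))$. Majorization property (for $|X|=n$): let $\mathcal I_n$ be the set of all finite sequences $(i_0,i_1,\ldots,i_k)\in\{1,\ldots,n\}^{k+1}$, $k\geqslant 1$, with $i_0\leqslant i_1\leqslant\ldots\leqslant i_k$. Given an enumeration $x_1,\ldots,x_n$ of the points of $X$ and two sequences $(i_0,\ldots,i_k),(j_0,\ldots,j_k)\in\mathcal I_n$ of the same length, write $(i_0,\ldots,i_k)\sim(j_0,\ldots,j_k)$ if there is a permutation $\pi$ of $\{1,\ldots,k\}$ with $\delta(x_{i_{l-1}},x_{i_l})=\delta(x_{j_{\pi(l)-1}},x_{j_{\pi(l)}})$ for all $l\in\{1,\ldots,k\}$; write $(i_0,\ldots,i_k)\prec(j_0,\ldots,j_k)$ if there is a permutation $\pi$ of $\{1,\ldots,k\}$ with $\delta(x_{i_{l-1}},x_{i_l})\leqslant\delta(x_{j_{\pi(l)-1}},x_{j_{\pi(l)}})$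 for all $l\in\{1,\ldots,k\}$, but not with equality for all $l$. The enumeration has the majorization property if for all $k\geqslant1$ and all $(i_0,\ldots,i_k),(j_0,\ldots,j_k)\in\mathcal I_n$: $(i_0,\ldots,i_k)\prec(j_0,\ldots,j_k)$ implies $\delta(x_{i_0},x_{i_k})<\delta(x_{j_0},x_{j_k})$, and $(i_0,\ldots,i_k)\sim(j_0,\ldots,j_k)$ implies $\delta(x_{i_0},x_{i_k})=\delta(x_{j_0},x_{j_k})$. *)

(* Defs.v *)
From HB Require Import structures.
From mathcomp Require Import all_boot all_order all_algebra all_fingroup.
From mathcomp Require Import reals.

Set Implicit Arguments.
Unset Strict Implicit.
Unset Printing Implicit Defensive.

Import Order.TTheory GRing.Theory Num.Theory.

(* The minimal element 0 of the linearly ordered set L is its bottom. *)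
Record is_ordinal_space (d : Order.disp_t) (X : Type) (L : bOrderType d)
    (delta : X -> X -> L) : Prop := IsOrdinalSpace {
  ordinal_surj : forall l : L, exists x y : X, delta x y = l ;
  ordinal_sym : forall x y : X, delta x y = delta y x ;
  ordinal_eq0 : forall x y : X, delta x y = \bot%O <-> x = y
}.

(* The norm that MathComp-Analysis puts on 'rV[R]_m is the sup norm. *)
Definition euclidean_dist (R : realType) (m : nat) (u v : 'rV[R]_m) : R :=
  Num.sqrt (\sum_(i < m) (u ord0 i - v ord0 i) ^+ 2)%R.

Definition embeddable (R : realType) (m : nat) (d : Order.disp_t) (X : Type)
    (L : bOrderType d) (delta : X -> X -> L) : Prop :=
  exists Phi : X -> 'rV[R]_m, forall x y z w : X,
    let dxy := euclidean_dist (Phi x) (Phi y) in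
    let dzw := euclidean_dist (Phi z) (Phi w) in
    [/\ (delta x y < delta z w)%O <-> (dxy < dzw)%R,
        delta x y = delta z w <-> dxy = dzw
      & (delta x y > delta z w)%O <-> (dxy > dzw)%R].

Section Majorization.
Variables (d : Order.disp_t) (X : Type) (L : bOrderType d).
Variables (delta : X -> X -> L) (n : nat) (x : 'I_n -> X).

(* A sequence (i_0, ..., i_k) is a function on 'I_k.+1; positions l in
   {1, ..., k} are shifted to 'I_k, so that seq_step i l is
   delta (x_(i_l)) (x_(i_(l+1))). *)
Definition nondecreasing_seq (k : nat) (i : 'I_k.+1 -> 'I_n) : Prop :=
  forall a b : 'I_k.+1, a <= b -> i a <= i b.

Definition seq_step (k : nat) (i : 'I_k.+1 -> 'I_n) (l : 'I_k) : L :=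
  delta (x (i (widen_ord (leqnSn k) l))) (x (i (lift ord0 l))).

Definition seq_span (k : nat) (i : 'I_k.+1 -> 'I_n) : L :=
  delta (x (i ord0)) (x (i ord_max)).

Definition seq_sim (k : nat) (i j : 'I_k.+1 -> 'I_n) : Prop :=
  exists p : 'S_k, forall l : 'I_k, seq_step i l = seq_step j (p l).

Definition seq_prec (k : nat) (i j : 'I_k.+1 -> 'I_n) : Prop :=
  exists p : 'S_k,
    (forall l : 'I_k, (seq_step i l <= seq_step j (p l))%O) /\
    ~ (forall l : 'I_k, seq_step i l = seq_step j (p l)).

Definition majorization : Prop :=
  forall (k : nat) (i j : 'I_k.+1 -> 'I_n), 1 <= k ->
    nondecreasing_seq i -> nondecreasing_seq j ->
    (seq_prec i j -> (seq_span i < seq_span j)%O) /\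
    (seq_sim i j -> seq_span i = seq_span j).

End Majorization.

(* Main.v *)
Require Import Defs.
From mathcomp Require Import all_boot all_order all_algebra all_fingroup.
From mathcomp Require Import reals.
From mathcomp Require Import zify.

Set Implicit Arguments.
Unset Strict Implicit.
Unset Printing Implicit Defensive.

Import Order.TTheory GRing.Theory Num.Theory.

(** Throughout, write d_ij for the value of delta on the i-th and j-th points of
    an enumeration, and let the gaps of four points on a line be the three
    distances between consecutive ones.

    From (i) to (ii), for any number of points: enumerate the points in the order
    in which they lie on the line.  The span of a nondecreasing sequence is then
    the sum of its steps, and sums respect permutations and termwise comparisons
    ([embeddable1_majorization]).

    From (ii) to (iii): sequences with two steps suffice.  Two of them whose
    steps match crosswise have spans that compare in the same way
    ([majorization_swap]).  Letting one step be zero gives the inequalities (1).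
    Comparing (1,2,3) with (2,3,4), which share the step d_23, gives (2).

    From (iii) to (i): only the order of the values of delta matters, so delta
    may be replaced by the ranks of its values, which are natural numbers.  The
    six distances of four points are a, b, c, a + b, b + c and a + b + c for gaps
    a, b, c.  Granted (iii), their order is determined by how a, b and c compare
    with each other, c with a + b, and a with b + c.  So it is enough to find
    gaps for which these five comparisons come out as prescribed
    ([line_gaps]).  Adding the same large constant to d_12, d_23 and d_34 keeps
    their order and makes each less than the sum of the other two; the only
    other cases are c >= a + b and a >= b + c, in which the long gap is set to
    that sum, or one more, and the two short ones are chosen as before. *)

(** * Comparisons and embeddings in the line *)

Lemma eq_of_le_iff (d d' : Order.disp_t) (T : porderType d) (T' : porderType d')
    (a b : T) (a' b' : T') :
  (a <= b)%O = (a' <= b')%O -> (b <= a)%O = (b' <= a')%O ->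
  a = b <-> a' = b'.
Proof.
move=> le_ab le_ba; split=> /eqP; rewrite eq_le.
  by rewrite le_ab le_ba => ?; apply/le_anti.
by rewrite -le_ab -le_ba => ?; apply/le_anti.
Qed.

Lemma euclidean_dist1 (R : realType) (u v : 'rV[R]_1) :
  euclidean_dist u v = (`|u ord0 ord0 - v ord0 ord0|)%R.
Proof. by rewrite /euclidean_dist big_ord1 sqrtr_sqr. Qed.

(** The three comparisons in the definition of an embedding all follow from the
    non-strict one because both orders are total. *)
Lemma embeddable1P (R : realType) (d : Order.disp_t) (X : Type)
    (L : bOrderType d) (delta : X -> X -> L) :
  embeddable R 1 delta <->
  exists f : X -> R, forall x y z w,
    (delta x y <= delta z w)%O = (`|f x - f y| <= `|f z - f w|)%R.
Proof.
split=> [[Phi PhiP]|[f fP]].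
  exists (fun x => Phi x ord0 ord0) => x y z w.
  have [_ _] := PhiP x y z w; rewrite !euclidean_dist1 => gtP.
  by rewrite !leNgt; congr (~~ _); apply/idP/idP => /gtP.
exists (fun x => \row_i f x)%R => x y z w; rewrite /= !euclidean_dist1 !mxE.
split; first by rewrite !ltNge fP.
  exact: eq_of_le_iff.
by rewrite !ltNge fP.
Qed.

(** * From an embedding to majorization *)

Lemma sorted_enumeration (d : Order.disp_t) (T : orderType d) (X : finType)
    (n : nat) (f : X -> T) :
  #|X| = n -> exists x : 'I_n -> X,
    bijective x /\ forall i j : 'I_n, i <= j -> (f (x i) <= f (x j))%O.
Proof.
move=> Xn; pose r := relpre f <=%O; pose s := sort r (enum X).
have r_total : total r by move=> x y; apply: le_total.
have r_trans : transitive r by move=> x y z; apply: le_trans.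
have size_s : size s == n by rewrite size_sort -cardT Xn.
exists (tnth (Tuple size_s)); split=> [|i j le_ij].
  apply: inj_card_bij; last by rewrite card_ord Xn.
  by apply/tuple_uniqP; rewrite sort_uniq enum_uniq.
have x0 : X by apply: tnth (Tuple size_s) i.
rewrite !(tnth_nth x0); apply: (sorted_leq_nth r_trans _ _ (sort_sorted _ _)) => //.
- by move=> x; apply: lexx.
- by rewrite inE (eqP size_s).
- by rewrite inE (eqP size_s).
Qed.

(** Telescoping: on a line, steps in one direction add up to the span. *)
Lemma monotone_path_length (R : numDomainType) (k : nat) (g : 'I_k.+1 -> R) :
  (forall a b : 'I_k.+1, a <= b -> (g a <= g b)%R) ->
  (`|g ord0 - g ord_max| =
   \sum_(l < k) `|g (widen_ord (leqnSn k) l) - g (lift ord0 l)|)%R.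
Proof.
move=> g_mono; rewrite distrC ger0_norm ?subr_ge0 ?g_mono ?leq0n //.
under eq_bigr => l _.
  rewrite distrC ger0_norm; last first.
    by rewrite subr_ge0 g_mono //= /bump /= add1n leqnSn.
  over.
rewrite sumrB; apply/eqP; rewrite subr_eq addrAC eq_sym subr_eq addrC.
have := big_ord_recl k (fun i => g i) : (\sum_(i < k.+1) g i = _)%R.
by rewrite big_ord_recr /= addrC => ->; rewrite addrC.
Qed.

Lemma ltr_sum_some (R : numDomainType) (k : nat) (a b : 'I_k -> R) :
  (forall l, a l <= b l)%R -> ~ (forall l, a l = b l) ->
  (\sum_l a l < \sum_l b l)%R.
Proof.
move=> le_ab ne_ab; rewrite lt_neqAle ler_sum ?andbT //.
apply/eqP => /esym/eqP; rewrite -subr_eq0 -sumrB => /eqP/psumr_eq0P sum0.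
case: ne_ab => l; apply/esym/eqP; rewrite -subr_eq0 sum0 // => i _.
by rewrite subr_ge0.
Qed.

Lemma embeddable1_majorization (R : realType) (d : Order.disp_t) (X : finType)
    (L : bOrderType d) (delta : X -> X -> L) (n : nat) :
  #|X| = n -> embeddable R 1 delta ->
  exists x : 'I_n -> X, bijective x /\ majorization delta x.
Proof.
move=> Xn /embeddable1P[f fP].
have [x [x_bij x_mono]] := sorted_enumeration f Xn.
have f_eq y z u v : delta y z = delta u v <-> (`|f y - f z| = `|f u - f v|)%R.
  exact: eq_of_le_iff.
exists x; split=> // k i j _ i_nd j_nd.
have span_le (h : 'I_k.+1 -> 'I_n) : nondecreasing_seq h ->
    forall a b : 'I_k.+1, (a <= b)%N -> (f (x (h a)) <= f (x (h b)))%R.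
  by move=> h_nd a b le_ab; apply/x_mono/h_nd.
split=> [[p [le_p ne_p]]|[p eq_p]].
  rewrite ltNge fP -ltNge (monotone_path_length (span_le _ i_nd)).
  rewrite (monotone_path_length (span_le _ j_nd)) [ltRHS](reindex_inj (@perm_inj _ p)).
  apply: ltr_sum_some => [l|eq_p]; first by rewrite -fP le_p.
  by apply: ne_p => l; apply/f_eq/eq_p.
apply/f_eq; rewrite (monotone_path_length (span_le _ i_nd)).
rewrite (monotone_path_length (span_le _ j_nd)) [RHS](reindex_inj (@perm_inj _ p)).
by apply: eq_bigr => l _; apply/f_eq/eq_p.
Qed.

(** * From majorization to the inequalities between distances *)

Section TwoSteps.
Variables (d : Order.disp_t) (X : Type) (L : bOrderType d).
Variables (delta : X -> X -> L) (n : nat) (x : 'I_n -> X).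
Hypothesis x_maj : majorization delta x.

(** The first step of each sequence is compared with the second step of the
    other.  The crosswise pairing is the only one that the consequences below
    call for: with a repeated index, it can pair the only nonzero step of one
    sequence with either step of the other. *)
Lemma majorization_swap (a b c a' b' c' : 'I_n) :
  a <= b <= c -> a' <= b' <= c' ->
  (delta (x a) (x b) <= delta (x b') (x c'))%O ->
  (delta (x b) (x c) <= delta (x a') (x b'))%O ->
  if (delta (x a) (x b) == delta (x b') (x c')) &&
     (delta (x b) (x c) == delta (x a') (x b'))
  then delta (x a) (x c) = delta (x a') (x c')
  else (delta (x a) (x c) < delta (x a') (x c'))%O.
Proof.
move=> abc abc' le1 le2.
pose path3 u v w : 'I_3 -> 'I_n := fun l => nth u [:: u; v; w] l.
have path3_nd (u v w : 'I_n) : u <= v <= w -> nondecreasing_seq (path3 u v w).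
  move=> /andP[uv vw]; have uw := leq_trans uv vw.
  by case=> [[|[|[|?]]] ?] [[|[|[|?]]] ?].
have [lt_span eq_span] :=
  x_maj (isT : 1 <= 2) (path3_nd _ _ _ abc) (path3_nd _ _ _ abc').
pose p : 'S_2 := perm (@rev_ord_inj 2).
have ord2_ind (P : 'I_2 -> Prop) : P ord0 -> P ord_max -> forall l, P l.
  move=> P0 P1 [[|[|//]] lt_l].
  - by rewrite (_ : Ordinal _ = ord0) //; apply: val_inj.
  - by rewrite (_ : Ordinal _ = ord_max) //; apply: val_inj.
case: ifP => [/andP[/eqP eq1 /eqP eq2]|/negP ne].
  by apply: eq_span; exists p; apply: ord2_ind; rewrite /seq_step permE.
apply: lt_span; exists p; split; first by apply: ord2_ind; rewrite /seq_step permE.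
move=> eq_p; apply: ne; have := eq_p ord0; have := eq_p ord_max.
by rewrite /seq_step !permE /path3 /= => -> ->; rewrite !eqxx.
Qed.

Hypothesis delta_space : is_ordinal_space delta.
Hypothesis x_inj : injective x.

Let delta_xx a : delta (x a) (x a) = \bot%O.
Proof. exact/(ordinal_eq0 delta_space). Qed.

Let delta_gt0 (a b : 'I_n) : a < b -> (\bot < delta (x a) (x b))%O.
Proof.
move=> lt_ab; rewrite lt0x; apply/eqP => /(ordinal_eq0 delta_space)/x_inj ab.
by rewrite ab ltnn in lt_ab.
Qed.

Lemma majorization_extend_right (a b c : 'I_n) :
  a <= b < c -> (delta (x a) (x b) < delta (x a) (x c))%O.
Proof.
move=> /andP[ab bc]; have bc0 := delta_gt0 bc.
(* The steps of (a, a, b) are zero and one of the two steps of (a, b, c). *)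
have := @majorization_swap a a b a b c.
by rewrite leqnn ab (ltnW bc) delta_xx le0x lexx (lt_eqF bc0); apply.
Qed.

Lemma majorization_extend_left (a b c : 'I_n) :
  a < b <= c -> (delta (x b) (x c) < delta (x a) (x c))%O.
Proof.
move=> /andP[ab bc]; have ab0 := delta_gt0 ab.
have := @majorization_swap b c c a b c.
by rewrite leqnn bc (ltnW ab) delta_xx le0x lexx (lt_eqF ab0) andbF; apply.
Qed.

(** The sequences (a, b, c) and (b, c, e) share the step from b to c, so their
    spans compare as their other steps do.  As the order is total, the
    implications for less, equal and greater yield both equivalences. *)
Lemma majorization_common_gap (a b c e : 'I_n) : a <= b -> b <= c -> c <= e ->
  ((delta (x a) (x c) < delta (x b) (x e))%O <->
   (delta (x a) (x b) < delta (x c) (x e))%O) /\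
  (delta (x a) (x c) = delta (x b) (x e) <->
   delta (x a) (x b) = delta (x c) (x e)).
Proof.
move=> ab bc ce.
have up := @majorization_swap a b c b c e.
have dn := @majorization_swap b c e a b c.
move: up dn; rewrite ab bc ce !lexx eqxx /= andbT => up dn.
case: (ltgtP (delta (x a) (x b)) (delta (x c) (x e))) up dn => [lt|gt|eq] up dn.
- have {up}lt' := up isT isT isT isT.
  rewrite lt'; split=> //.
  by split=> eq; [rewrite eq ltxx in lt' | rewrite eq ltxx in lt].
- have {dn}gt' := dn isT isT isT isT.
  rewrite lt_gtF //; split=> //.
  by split=> eq; [rewrite eq ltxx in gt' | rewrite eq ltxx in gt].
- have {up}eq' := up isT isT isT isT.
  by rewrite eq' ltxx.
Qed.

End TwoSteps.

(** * Four points on a line *)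

(** The absolute difference: one of the two truncated subtractions is 0. *)
Definition distn (m n : nat) : nat := (m - n) + (n - m).

Lemma distnr (R : numDomainType) (m n : nat) :
  (`|m%:R - n%:R| = (distn m n)%:R :> R)%R.
Proof.
rewrite /distn; case: (leqP m n) => [le_mn|/ltnW le_nm].
  by rewrite distrC -natrB // ger0_norm ?ler0n // (eqP le_mn).
by rewrite -natrB // ger0_norm ?ler0n // (eqP le_nm) addn0.
Qed.

Lemma ord4P (P : 'I_4 -> Prop) :
  P (inord 0) -> P (inord 1) -> P (inord 2) -> P (inord 3) -> forall i, P i.
Proof.
move=> P0 P1 P2 P3 i; rewrite -(inord_val i).
by case: i => [[|[|[|[|]]]]].
Qed.

Local Notation i1 := (inord 0 : 'I_4).
Local Notation i2 := (inord 1 : 'I_4).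
Local Notation i3 := (inord 2 : 'I_4).
Local Notation i4 := (inord 3 : 'I_4).

(** Condition (iii) as a property of the matrix of distances; it is stated for
    any order so that it can be moved from delta to its ranks. *)
Definition line_pattern (d : Order.disp_t) (T : porderType d)
    (D : 'I_4 -> 'I_4 -> T) : Prop :=
  (((D i1 i2 < D i1 i3)%O /\ (D i1 i3 < D i1 i4)%O /\
    (D i1 i4 > D i2 i4)%O /\ (D i2 i4 > D i3 i4)%O) /\
   (D i2 i3 < D i1 i3)%O /\ (D i2 i3 < D i2 i4)%O) /\
  (((D i1 i3 < D i2 i4)%O <-> (D i1 i2 < D i3 i4)%O) /\
   (D i1 i3 = D i2 i4 <-> D i1 i2 = D i3 i4)).

Definition same_comparison (a b a' b' : nat) : Prop :=
  (a <= b) = (a' <= b') /\ (b <= a) = (b' <= a').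

(** The numbers d_12, d_23, d_34 and d_14 are positive and d_14 exceeds the first
    three.  Hence the sum of two of the numbers d_14 + d_12, d_14 + d_23 and
    d_14 + d_34 exceeds the third, so these serve as gaps unless d_34 >= d_13 or
    d_12 >= d_24.  These two exceptions exclude each other, as d_13 > d_12 and
    d_24 > d_34. *)
Lemma line_gaps (d12 d13 d14 d23 d24 d34 : nat) :
  [/\ 0 < d12, 0 < d23 & 0 < d34] ->
  [/\ d12 < d13, d13 < d14, d24 < d14 & d34 < d24] ->
  d23 < d13 -> d23 < d24 ->
  (d13 < d24 <-> d12 < d34) -> (d13 = d24 <-> d12 = d34) ->
  exists a b c : nat, [/\ 0 < a, 0 < b & 0 < c] /\
    [/\ same_comparison d12 d23 a b, same_comparison d23 d34 b c,
        same_comparison d12 d34 a c, same_comparison d34 d13 c (a + b)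
      & same_comparison d12 d24 a (b + c)].
Proof.
rewrite /same_comparison => -[p12 p23 p34] [h1 h2 h3 h4] h5 h6 h7 h8.
(* The boolean d13 < d34 is the extra unit that makes c exceed a + b. *)
case: (ltnP d34 d13) => [c_short|c_long]; last first.
  exists (d14 + d12), (d14 + d23), ((d14 + d12) + (d14 + d23) + (d13 < d34)).
  by split; repeat split; lia.
case: (ltnP d12 d24) => [a_short|a_long]; last first.
  exists ((d14 + d23) + (d14 + d34) + (d24 < d12)), (d14 + d23), (d14 + d34).
  by split; repeat split; lia.
exists (d14 + d12), (d14 + d23), (d14 + d34).
by split; repeat split; lia.
Qed.

(** The points are put at 0, a, a + b and a + b + c, with the gaps a, b, c of
    [line_gaps].  Each further comparison of two distances follows from the five
    given there and from the pattern, by linear arithmetic. *)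
Lemma line_pattern_realizable (D : 'I_4 -> 'I_4 -> nat) :
  (forall i j, D i j = D j i) -> (forall i j, (D i j == 0) = (i == j)) ->
  line_pattern D ->
  exists p : 'I_4 -> nat, forall i j k l,
    (D i j <= D k l) = (distn (p i) (p j) <= distn (p k) (p l)).
Proof.
move=> Dsym D0.
have Dii i : D i i = 0 by apply/eqP; rewrite D0.
have [p12 p23 p34] : [/\ 0 < D i1 i2, 0 < D i2 i3 & 0 < D i3 i4].
  by split; rewrite lt0n D0 -val_eqE /= !inordK.
rewrite /line_pattern !ltEnat /= => -[[[h1 [h2 [h3 h4]]] [h5 h6]] [h7 h8]].
have [a [b [c [[a0 b0 c0] abcP]]]] :=
  line_gaps (And3 p12 p23 p34) (And4 h1 h2 h3 h4) h5 h6 h7 h8.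
pose p (i : 'I_4) := nth 0 [:: 0; a; a + b; a + b + c] i.
have p1 : p i1 = 0 by rewrite /p inordK.
have p2 : p i2 = a by rewrite /p inordK.
have p3 : p i3 = a + b by rewrite /p inordK.
have p4 : p i4 = a + b + c by rewrite /p inordK.
exists p; pose E i j := distn (p i) (p j).
have Esym i j : E i j = E j i by rewrite /E /distn addnC.
have Eii i : E i i = 0 by rewrite /E /distn subnn.
have [E12 E23 E34] : [/\ E i1 i2 = a, E i2 i3 = b & E i3 i4 = c].
  by rewrite /E p1 p2 p3 p4 /distn; split; lia.
have [E13 E24 E14] : [/\ E i1 i3 = a + b, E i2 i4 = b + c & E i1 i4 = a + b + c].
  by rewrite /E p1 p2 p3 p4 /distn; split; lia.
(* The pairs of corresponding values: 7 instead of 16, by symmetry. *)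
pose vals : seq (nat * nat) := [:: (0, 0); (D i1 i2, a); (D i2 i3, b); (D i3 i4, c);
  (D i1 i3, a + b); (D i2 i4, b + c); (D i1 i4, a + b + c)].
have DE_vals i j : (D i j, E i j) \in vals.
  have D_flip := (Dsym i2 i1, Dsym i3 i1, Dsym i4 i1,
                  Dsym i3 i2, Dsym i4 i2, Dsym i4 i3).
  have E_flip := (Esym i2 i1, Esym i3 i1, Esym i4 i1,
                  Esym i3 i2, Esym i4 i2, Esym i4 i3).
  have E_val := (E12, E23, E34, E13, E24, E14).
  move: i j; do 2!elim/ord4P;
    by rewrite ?D_flip ?E_flip ?E_val ?Dii ?Eii !inE eqxx ?orbT.
have vals_le u v : u \in vals -> v \in vals -> (u.1 <= v.1) = (u.2 <= v.2).
  case: abcP => -[k1 k1'] [k2 k2'] [k3 k3'] [k4 k4'] [k5 k5'].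
  clear -p12 p23 p34 h1 h2 h3 h4 h5 h6 h7 h8 a0 b0 c0
         k1 k1' k2 k2' k3 k3' k4 k4' k5 k5'.
  rewrite !inE.
  by move=> /or4P[|||/or4P[]] /eqP -> /or4P[|||/or4P[]] /eqP -> /=; lia.
move=> i j k l; exact: vals_le (DE_vals i j) (DE_vals k l).
Qed.

(** * From the inequalities to an embedding *)

Section Ranks.
Variables (d : Order.disp_t) (T : finType) (L : orderType d) (F : T -> L).

Definition rank (t : T) : nat := #|[set s | (F s < F t)%O]|.

(** Ranks represent the order of finitely many values by natural numbers, on
    which linear arithmetic is available. *)
Lemma rank_le (s t : T) : (rank s <= rank t) = (F s <= F t)%O.
Proof.
case: (leP (F s) (F t)) => [le_st|lt_ts].
  by apply/subset_leq_card/subsetP => u; rewrite !inE => /lt_le_trans; apply.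
apply/negbTE; rewrite -ltnNge; apply/proper_card/properP; split.
  by apply/subsetP => u; rewrite !inE => /lt_trans; apply.
by exists t; rewrite !inE ?ltxx.
Qed.

End Ranks.

Lemma line_pattern_transfer (d d' : Order.disp_t) (T : orderType d)
    (T' : orderType d') (D : 'I_4 -> 'I_4 -> T) (D' : 'I_4 -> 'I_4 -> T') :
  (forall i j k l, (D i j <= D k l)%O = (D' i j <= D' k l)%O) ->
  line_pattern D -> line_pattern D'.
Proof.
move=> le_DD'.
have lt_DD' i j k l : (D' i j < D' k l)%O = (D i j < D k l)%O.
  by rewrite !ltNge le_DD'.
have eq_DD' i j k l : D' i j = D' k l <-> D i j = D k l.
  exact: eq_of_le_iff.
by rewrite /line_pattern !lt_DD' !eq_DD'.
Qed.

Lemma line_pattern_embeddable (R : realType) (d : Order.disp_t) (X : finType)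
    (L : bOrderType d) (delta : X -> X -> L) (x : 'I_4 -> X) :
  is_ordinal_space delta -> bijective x ->
  line_pattern (fun i j => delta (x i) (x j)) -> embeddable R 1 delta.
Proof.
move=> delta_space [y xK yK] x_line.
pose D i j := rank (fun q => delta q.1 q.2) (x i, x j).
have D_le i j k l : (delta (x i) (x j) <= delta (x k) (x l))%O =
    (D i j <= D k l)%O by rewrite leEnat rank_le.
have D_line := line_pattern_transfer D_le x_line.
have Dsym i j : D i j = D j i.
  by rewrite /D /rank /= (ordinal_sym delta_space).
have D0 i j : (D i j == 0) = (i == j).
  rewrite cards_eq0; apply/eqP/eqP => [no_lt|->].
    apply/(can_inj xK)/(ordinal_eq0 delta_space)/le_anti; rewrite le0x andbT.
    have /setP/(_ (x i, x i)) := no_lt; rewrite !inE /=.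
    by rewrite (ordinal_eq0 delta_space (x i) (x i)).2 // leNgt => ->.
  apply/setP => u; rewrite !inE /= (ordinal_eq0 delta_space (x j) (x j)).2 //.
  by rewrite ltx0.
have [p pP] := line_pattern_realizable Dsym D0 D_line.
apply/embeddable1P; exists (fun z => (p (y z))%:R%R) => z w u v.
by rewrite !distnr ler_nat -pP -leEnat -D_le !yK.
Qed.

Lemma majorization_line_pattern (d : Order.disp_t) (X : finType)
    (L : bOrderType d) (delta : X -> X -> L) (x : 'I_4 -> X) :
  is_ordinal_space delta -> injective x -> majorization delta x ->
  line_pattern (fun i j => delta (x i) (x j)).
Proof.
move=> delta_space x_inj x_maj.
have right := majorization_extend_right x_maj delta_space x_inj.
have left := majorization_extend_left x_maj delta_space x_inj.
split; last by apply: (majorization_common_gap x_maj); rewrite !inordK.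
by do !split; (apply: right || apply: left); rewrite !inordK.
Qed.

Theorem theorem7p5 (R : realType) (d : Order.disp_t) (X : finType)
    (L : bOrderType d) (delta : X -> X -> L)
    (hdelta : is_ordinal_space delta) (hX : #|X| = 4) :
  let cond_i := embeddable R 1 delta in
  let cond_ii :=
    exists x : 'I_4 -> X, bijective x /\ majorization delta x in
  let cond_iii :=
    exists x : 'I_4 -> X, bijective x /\
      let x1 := x (inord 0) in
      let x2 := x (inord 1) in
      let x3 := x (inord 2) in
      let x4 := x (inord 3) in
      (((delta x1 x2 < delta x1 x3)%O /\ (delta x1 x3 < delta x1 x4)%O /\
        (delta x1 x4 > delta x2 x4)%O /\ (delta x2 x4 > delta x3 x4)%O) /\
       (delta x2 x3 < delta x1 x3)%O /\ (delta x2 x3 < delta x2 x4)%O) /\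
      (((delta x1 x3 < delta x2 x4)%O <-> (delta x1 x2 < delta x3 x4)%O) /\
       (delta x1 x3 = delta x2 x4 <-> delta x1 x2 = delta x3 x4)) in
  (cond_i <-> cond_ii) /\ (cond_ii <-> cond_iii).
Proof.
move=> cond_i cond_ii cond_iii.
have i_ii : cond_i -> cond_ii := embeddable1_majorization hX.
have ii_iii : cond_ii -> cond_iii.
  move=> [x [x_bij x_maj]]; exists x; split=> //.
  exact: majorization_line_pattern hdelta (bij_inj x_bij) x_maj.
have iii_i : cond_iii -> cond_i.
  by move=> [x [x_bij x_line]]; apply: line_pattern_embeddable hdelta x_bij x_line.
by split; split=> // h; [apply/iii_i/ii_iii | apply/i_ii/iii_i].
Qed.
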